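(* When $\tau=m/2$, there exists an instance with $m=3$ projects for which no budget-feasible solution satisfies more than $\frac{2n}{3}+1$ agents, where $n$ is the number of agents of the instance.
   Context: An instance with a set of agents $[n]=\{1,\dots,n\}$ and $m$ projects consists of demands $d^i_j\in[0,1]$ for $i\in[n]$ and $j\in[m]=\{1,\dots,m\}$, with $\sum_{j=1}^m d^i_j\le 1$ for every agent $i$. A solution is a vector $\mathbf{x}\in[0,1]^m$; it is budget-feasible if $\sum_{j=1}^m x_j\le 1$. Agent $i$ is locally satisfied by $\mathbf{x}$ for project $j$ if $x_j\ge d^i_j$. Given a threshold $\tau\in[1,m]$ (not necessarily an integer), agent $i$ is satisfied by $\mathbf{x}$ if she is locally satisfied by $\mathbf{x}$ for at least $\tau$ projects (so for $m=3$ and $\tau=m/2$, for at least $2$ projects). *)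

(* Defs.v *)
From HB Require Import structures.
From mathcomp Require Import all_boot all_order all_algebra.
Set Implicit Arguments.
Unset Strict Implicit.
Unset Printing Implicit Defensive.
Import Order.TTheory GRing.Theory Num.Theory.
Local Open Scope ring_scope.

(* Agents are the elements of 'I_n and projects those of 'I_m, so d i j is the
   demand of agent i for project j.  The reals are replaced by an arbitrary
   ordered field. *)

Record is_instance (R : realFieldType) (n m : nat)
    (d : 'I_n -> 'I_m -> R) : Prop := IsInstance {
  demand_itv : forall i j, 0 <= d i j <= 1;
  demand_sum : forall i, \sum_(j < m) d i j <= 1
}.

Definition is_solution (R : realFieldType) (m : nat) (x : 'I_m -> R) : Prop :=
  forall j, 0 <= x j <= 1.

Definition budget_feasible (R : realFieldType) (m : nat) (x : 'I_m -> R) :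
    Prop :=
  \sum_(j < m) x j <= 1.

Definition locally_satisfied (R : realFieldType) (n m : nat)
    (d : 'I_n -> 'I_m -> R) (x : 'I_m -> R) (i : 'I_n) (j : 'I_m) : bool :=
  d i j <= x j.

Definition satisfied (R : realFieldType) (n m : nat) (tau : R)
    (d : 'I_n -> 'I_m -> R) (x : 'I_m -> R) (i : 'I_n) : bool :=
  tau <= #|[set j | locally_satisfied d x i j]|%:R.

Definition satisfied_agents (R : realFieldType) (n m : nat) (tau : R)
    (d : 'I_n -> 'I_m -> R) (x : 'I_m -> R) : {set 'I_n} :=
  [set i | satisfied tau d x i].

(* Main.v *)
(* Write s_i for the i-th of n small increasing offsets.  The demands are the
   cyclic shifts of (1/2 + s_i, 1/2 - s_i, 0), the shift being -i modulo 3.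
   A budget-feasible x has a coordinate c with x_c <= 1/3; let a and b be the
   two coordinates following c cyclically.  The agents with demands on both a
   and b may all be satisfied.  Those with demands on b and c need
   1/2 + s_i <= x_b, and those with demands on c and a need 1/2 - s_k <= x_a;
   as x_a + x_b <= 1, satisfying both forces s_i <= s_k.  So the satisfied
   agents of the former kind all precede those of the latter kind, and in total
   about a third of the agents are unsatisfied. *)
Require Import Defs.
From HB Require Import structures.
From mathcomp Require Import all_boot all_order all_algebra.
From mathcomp Require Import zify lra.
Set Implicit Arguments.
Unset Strict Implicit.
Unset Printing Implicit Defensive.
Import Order.TTheory GRing.Theory Num.Theory.
Local Open Scope ring_scope.

(** Differences of the quotients count the excluded indices: multiples of 3 in [[c, c + minn n T)]
    and numbers congruent to 1 in [[T + c, maxn n T + c)]. The subtracted quotients stand on the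
    right because subtraction on [nat] truncates. *)
Lemma sum_residue_cut (c T n : nat) :
  (\sum_(i < n) (if i < T then (i + c) %% 3 != 0 else (i + c) %% 3 != 1)
   + ((minn n T + c + 2) %/ 3 + (maxn n T + c + 1) %/ 3)
   = n + ((c + 2) %/ 3 + (T + c + 1) %/ 3))%N.
Proof.
elim: n => [|n IHn]; first by rewrite big_ord0; lia.
rewrite big_ord_recr /=; set s := (\sum_(i < n) _)%N in IHn *.
by case: (ltnP n T) => nT; case: eqP => /= rn; lia.
Qed.

(** Cut just past the last element of [S] of residue 1: below the cut [S] has no residue 0, from the
    cut on no residue 1. *)
Lemma card_residue_separated (n c : nat) (S : {set 'I_n}) :
  (c < 3)%N ->
  {in S &, forall i k : 'I_n,
    (i + c) %% 3 = 1 -> (k + c) %% 3 = 0 -> i <= k}%N ->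
  (3 * #|S| <= 2 * n + 3)%N.
Proof.
move=> c3 sepS.
pose T := (\max_(i in S | (i + c) %% 3 == 1) i.+1)%N.
have Tn : (T <= n)%N by apply/bigmax_leqP => i _; exact: ltn_ord.
have leS : (#|S| <= \sum_(i < n)
    (if i < T then (i + c) %% 3 != 0 else (i + c) %% 3 != 1))%N.
  rewrite -sum1_card big_mkcond /=; apply: leq_sum => k _.
  case: ifP => // kS; case: (ltnP k T) => kT.
    have [rk|//] := eqVneq ((k + c) %% 3)%N 0%N.
    suff : (T <= k)%N by rewrite leqNgt kT.
    apply/bigmax_leqP => i /andP[iS /eqP ri].
    (* The inequality is strict because [i] and [k] have different residues. *)
    rewrite ltn_neqAle (sepS i k iS kS ri rk) andbT.
    by apply: contra_eqN ri => /eqP->; rewrite rk.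
  have [rk|//] := eqVneq ((k + c) %% 3)%N 1%N.
  have : (k < T)%N.
    by apply: (leq_bigmax_cond (F := fun i : 'I_n => i.+1)); rewrite kS rk.
  by rewrite ltnNge kT.
(* Exact counts matter: rounding down separately on each side of [T] would only give [2 * n + 4]. *)
by have := sum_residue_cut c T n; lia.
Qed.

Section CyclicInstance.
Variables (R : realFieldType) (n : nat).

(** The factor 6 keeps both nonzero demands of an agent above 1/3. *)
Definition offset (i : nat) : R := i.+1%:R / (6 * n.+1%:R).

Definition cyclic_demand (i : 'I_n) (j : 'I_3) : R :=
  if ((i + j) %% 3 == 0)%N then 1 / 2 + offset i
  else if ((i + j) %% 3 == 1)%N then 1 / 2 - offset i else 0.

Lemma offset_itv (i : 'I_n) : 0 < offset i < 1 / 6.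
Proof.
have n0 : 0 < n.+1%:R :> R by rewrite ltr0n.
have ilt : i.+1%:R < n.+1%:R :> R by rewrite ltr_nat ltnS.
rewrite /offset divr_gt0 ?ltr0n ?mulr_gt0 //=.
by rewrite ltr_pdivrMr ?mulr_gt0 //; lra.
Qed.

Lemma le_offset (i k : nat) : (offset i <= offset k) = (i <= k)%N.
Proof. by rewrite /offset ler_pM2r ?invr_gt0 ?mulr_gt0 ?ltr0n // ler_nat. Qed.

Lemma cyclic_demand_is_instance : is_instance cyclic_demand.
Proof.
split=> [i j|i].
  have /andP[s0 s1] := offset_itv i.
  by rewrite /cyclic_demand; case: ifP => _; last case: ifP => _; apply/andP; split; lra.
rewrite !big_ord_recr big_ord0 /= /cyclic_demand /= addn0.
have : (i %% 3 < 3)%N by rewrite ltn_mod.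
rewrite -(modnDml i 1) -(modnDml i 2); move: (i %% 3)%N.
by case=> [|[|[|]]] //= _; lra.
Qed.

(** An integer at least 3/2 is at least 2, so a satisfied agent misses at most one project. *)
Lemma two_of_three_satisfied (d : 'I_n -> 'I_3 -> R) x i (j k : 'I_3) :
  satisfied (3%:R / 2%:R) d x i -> j != k -> (d i j <= x j) || (d i k <= x k).
Proof.
rewrite /satisfied => sat jk; apply/negPn/negP; rewrite negb_or => /andP[nj nk].
have : (#|[set l | locally_satisfied d x i l]| <= 1)%N.
  have sub : [set l | locally_satisfied d x i l] \subset ~: [set j; k].
    apply/subsetP => l; rewrite !inE /locally_satisfied => dl.
    by apply/norP; split; apply: contraL dl => /eqP->.
  have := subset_leq_card sub.
  by rewrite [X in (_ <= X)%N]cardsCs setCK card_ord cards2 jk.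
by rewrite -(ler_nat R) => le1; have := le_trans sat le1; lra.
Qed.

Lemma card_satisfied_cyclic (x : 'I_3 -> R) (a b c : 'I_3) :
  a = ((c + 1) %% 3)%N :> nat -> b = ((c + 2) %% 3)%N :> nat ->
  x c <= 1 / 3 -> x a + x b <= 1 ->
  (3 * #|satisfied_agents (3%:R / 2%:R) cyclic_demand x| <= 2 * n + 3)%N.
Proof.
move=> ea eb xc xab.
apply: (@card_residue_separated n c) => // i k; rewrite !inE => si sk ri rk.
have c3 := ltn_ord c.
have bc : b != c by rewrite -val_eqE /=; apply/eqP; lia.
have ac : a != c by rewrite -val_eqE /=; apply/eqP; lia.
have rib : ((i + b) %% 3)%N = 0%N by lia.
have rka : ((k + a) %% 3)%N = 1%N by lia.
have /andP[i0 i6] := offset_itv i; have /andP[k0 k6] := offset_itv k.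
have := two_of_three_satisfied si bc; have := two_of_three_satisfied sk ac.
rewrite /cyclic_demand ri rk rib rka /= -le_offset.
(* Local satisfaction at [c] would contradict [xc]; in the remaining case the bounds on [x a] and
   [x b] are added. *)
by move=> /orP[ha|ha] /orP[hb|hb]; lra.
Qed.

End CyclicInstance.

Theorem theorem2 (R : realFieldType) (n : nat) :
  exists d : 'I_n -> 'I_3 -> R,
    is_instance d /\
    forall x : 'I_3 -> R, is_solution x -> budget_feasible x ->
      #|satisfied_agents (3%:R / 2%:R) d x|%:R <= 2%:R * n%:R / 3%:R + 1 :> R.
Proof.
exists (@cyclic_demand R n); split; first exact: cyclic_demand_is_instance.
move=> x x01.
pose o0 : 'I_3 := @Ordinal 3 0 isT; pose o1 : 'I_3 := @Ordinal 3 1 isT.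
pose o2 : 'I_3 := @Ordinal 3 2 isT.
have -> : budget_feasible x = (x o0 + x o1 + x o2 <= 1).
  rewrite /budget_feasible !big_ord_recr big_ord0 /= add0r.
  by congr (is_true (x _ + x _ + x _ <= 1)); apply: val_inj.
move=> xsum.
have /andP[p0 _] := x01 o0; have /andP[p1 _] := x01 o1.
have /andP[p2 _] := x01 o2.
suff : (3 * #|satisfied_agents (3%:R / 2%:R) (@cyclic_demand R n) x|
        <= 2 * n + 3)%N.
  by rewrite -(ler_nat R) natrD !natrM; lra.
(* Some coordinate is at most 1/3; as it is nonnegative, the other two sum to at most 1. *)
have [x0|x0] := leP (x o0) (1 / 3).
  by apply: (@card_satisfied_cyclic _ _ x o1 o2 o0) => //; lra.
have [x1|x1] := leP (x o1) (1 / 3).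
  by apply: (@card_satisfied_cyclic _ _ x o2 o0 o1) => //; lra.
by apply: (@card_satisfied_cyclic _ _ x o0 o1 o2) => //; lra.
Qed.
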